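(* A metric space has strict $2$-negative type if and only if it is isometric to an affinely independent subset of some real Hilbert space. In particular, no metric space $(X,d)$ of strict $2$-negative type is isometric to any affinely dependent metric subspace of any (real or complex) Hilbert space $H$, where $H$ is considered as a real vector space for the notion of affine dependence.
   Context: A metric space $(X,d)$ has $2$-negative type if for all finite sets of distinct points $\{z_1,\ldots,z_n\}\subseteq X$ and all real $\alpha_1,\ldots,\alpha_n$ with $\alpha_1+\cdots+\alpha_n=0$ we have $\sum_{j,i=1}^n d(z_j,z_i)^2\alpha_j\alpha_i\le 0$; it has strict $2$-negative type if moreover this inequality is strict unless $\alpha_1=\cdots=\alpha_n=0$. A (possibly infinite) subset $Z$ of a real vector space is affinely independent if for every finite set of distinct points $z_0,z_1,\ldots,z_n\in Z$ the vectors $z_1-z_0,\ldots,z_n-z_0$ are linearly independent over $\mathbb{R}$; otherwise it is affinely dependent. *)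

(* Defs.v *)
From HB Require Import structures.
From mathcomp Require Import all_boot all_order all_algebra.
From mathcomp Require Import sesquilinear.
From mathcomp Require Import all_classical all_reals all_analysis.
From mathcomp Require Import complex.

Set Implicit Arguments.
Unset Strict Implicit.
Unset Printing Implicit Defensive.

Import Order.TTheory GRing.Theory Num.Theory.
Import numFieldNormedType.Exports.

Local Open Scope classical_set_scope.
Local Open Scope ring_scope.
Local Open Scope complex_scope.

(* Finite sets of distinct points are enumerated by injections z : 'I_n -> X. *)
Definition negative_type2 (R : realType) (X : metricType R) : Prop :=
  forall (n : nat) (z : 'I_n -> X) (alpha : 'I_n -> R),
    injective z -> \sum_i alpha i = 0 ->
    \sum_j \sum_i mdist (z j) (z i) ^+ 2 * alpha j * alpha i <= 0.

Definition strict_negative_type2 (R : realType) (X : metricType R) : Prop :=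
  negative_type2 X /\
  forall (n : nat) (z : 'I_n -> X) (alpha : 'I_n -> R),
    injective z -> \sum_i alpha i = 0 ->
    ~ (forall i, alpha i = 0) ->
    \sum_j \sum_i mdist (z j) (z i) ^+ 2 * alpha j * alpha i < 0.

Definition linearly_independent (R : realType) (V : lmodType R) (n : nat)
    (v : 'I_n -> V) : Prop :=
  forall a : 'I_n -> R, \sum_i a i *: v i = 0 -> forall i, a i = 0.

(* [lift ord0 i] runs through the nonzero indices 1, ..., n of 'I_n.+1. *)
Definition affinely_independent (R : realType) (V : lmodType R) (Z : set V) :
    Prop :=
  forall (n : nat) (z : 'I_n.+1 -> V), injective z -> (forall i, Z (z i)) ->
    linearly_independent (fun i : 'I_n => z (lift ord0 i) - z ord0).

Definition affinely_dependent (R : realType) (V : lmodType R) (Z : set V) :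
    Prop :=
  ~ affinely_independent Z.

(* [theta] is the conjugation of the scalar field; [{dot V for theta}] is
   linear in its first argument and [theta]-semilinear in the second. *)
Record hilbertSpace (K : numFieldType) (theta : K -> K) := HilbertSpace {
  hilbert_sort :> completeNormedModType K ;
  inner : {dot hilbert_sort for theta} ;
  inner_norm : forall u : hilbert_sort, inner u u = `|u| ^+ 2 }.

Definition realHilbert (R : realType) := @hilbertSpace R idfun.

Definition complexHilbert (R : realType) := @hilbertSpace R[i] Num.conj.

(* A complex vector space regarded as a real one. *)
Definition as_real (R : realType) (V : lmodType R[i]) : Type := V.

Section RestrictionOfScalars.
Variables (R : realType) (V : lmodType R[i]).

HB.instance Definition _ := GRing.Zmodule.on (as_real V).

Definition real_scale (a : R) (v : as_real V) : as_real V :=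
  (a%:C *: (v : V) : V).

Fact real_scaleA (a b : R) (v : as_real V) :
  real_scale a (real_scale b v) = real_scale (a * b) v.
Proof. by rewrite /real_scale scalerA -rmorphM. Qed.

Fact real_scale1 : left_id 1 real_scale.
Proof. by move=> v; rewrite /real_scale rmorph1 scale1r. Qed.

Fact real_scaleDr : right_distributive real_scale +%R.
Proof. by move=> a u v; exact: (@scalerDr _ V). Qed.

Fact real_scaleDl (v : as_real V) :
  {morph real_scale^~ v : a b / a + b}.
Proof. by move=> a b; rewrite /real_scale rmorphD; exact: (@scalerDl _ V). Qed.

HB.instance Definition _ := GRing.Zmodule_isLmodule.Build R (as_real V)
  real_scaleA real_scale1 real_scaleDr real_scaleDl.

End RestrictionOfScalars.

(* Norms of a normed K-module are K-valued, so the distances of X are compared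
   with them through an embedding iota of the reals into K. *)
Definition isometric_via (R : realType) (K : numFieldType) (iota : R -> K)
    (X : metricType R) (H : normedModType K) (Z : set H) : Prop :=
  exists f : X -> H,
    (forall x y, `|f x - f y| = iota (mdist x y)) /\ range f = Z.

Definition isometric_real (R : realType) (X : metricType R)
    (H : realHilbert R) (Z : set H) : Prop :=
  isometric_via idfun X Z.

Definition isometric_complex (R : realType) (X : metricType R)
    (H : complexHilbert R) (Z : set H) : Prop :=
  isometric_via (fun r : R => r%:C) X Z.

(* Main.v *)
Require Import Defs.
From HB Require Import structures.
From mathcomp Require Import all_boot all_order all_algebra.
From mathcomp Require Import sesquilinear ring lra.
From mathcomp Require Import all_classical all_reals all_analysis.
From mathcomp Require Import complex.

Set Implicit Arguments.
Unset Strict Implicit.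
Unset Printing Implicit Defensive.

Import Order.TTheory GRing.Theory Num.Theory.
Import numFieldNormedType.Exports.

Local Open Scope classical_set_scope.
Local Open Scope ring_scope.

(** If f is an isometry into a real inner product space and the alpha_i sum to
    0, then the sum of the d(x_j, x_i)^2 alpha_j alpha_i is
    -2 |sum_i alpha_i f(x_i)|^2, and an affine dependence between the f(x_i) is
    exactly a nonzero such alpha with sum_i alpha_i f(x_i) = 0. Hence strict
    2-negative type is affine independence of the image. A complex Hilbert space
    carries the real inner product Re <u, v>, so the same argument applies there.

    Conversely, if X has 2-negative type, then -1/2 sum d(x, y)^2 c_x c'_y is a
    positive semidefinite form on the formal combinations of points with
    coefficients summing to 0, and |(x - o) - (y - o)| = d(x, y) for it. Its
    Hilbert completion is realised as a space of functions, so that no quotient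
    is needed: the functionals which are limits, in the dual norm, of those of
    the form <c, ->. *)

(** * Strict 2-negative type and affine dependences in an isometric image *)

Section AffineIndependence.
Variables (R : realType) (X : metricType R) (V : lmodType R).
Variables (g : {dot V for idfun}) (f : X -> V).
Hypothesis isom_f : forall x y, g (f x - f y) (f x - f y) = mdist x y ^+ 2.

Lemma dotC u v : g u v = g v u.
Proof. by rewrite hermC expr0 mul1r. Qed.

Lemma dotBl u v w : g (u - v) w = g u w - g v w.
Proof. exact: linearBl. Qed.

Lemma dotBr u v w : g u (v - w) = g u v - g u w.
Proof. exact: linearBr. Qed.

Lemma dot0 : g 0 0 = 0.
Proof. exact: linear0r. Qed.

Lemma dot_sumZ n (a : 'I_n -> R) (v : 'I_n -> V) :
  g (\sum_i a i *: v i) (\sum_i a i *: v i) =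
  \sum_j \sum_i a j * (a i * g (v j) (v i)).
Proof.
transitivity (\sum_j g (a j *: v j) (\sum_i a i *: v i)).
  exact: linear_sumlz.
apply: eq_bigr => j _; transitivity (a j * g (v j) (\sum_i a i *: v i)).
  exact: linearZl_LR.
rewrite -mulr_sumr; congr (_ * _).
transitivity (\sum_i g (v j) (a i *: v i)); first exact: linear_sumr.
by apply: eq_bigr => i _; exact: linearZr_LR.
Qed.

Lemma dot_ge0 u : 0 <= g u u.
Proof.
have [->|/(neq0_dnorm_gt0 (s := g))/ltW//] := eqVneq u 0.
by rewrite dot0.
Qed.

Lemma isom_inj : injective f.
Proof.
move=> x y fxy; apply: mdist_positivity; apply/eqP.
by rewrite -sqrf_eq0 -isom_f fxy subrr dot0.
Qed.

(** After expanding |f(x_j) - f(x_i)|^2, each of the two square terms depends on one index only, so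
    summing over the other gives the factor [\sum_i alpha i = 0]. Only the cross terms survive. *)
Lemma sum_mdist2 n (z : 'I_n -> X) (alpha : 'I_n -> R) :
  \sum_i alpha i = 0 ->
  \sum_j \sum_i mdist (z j) (z i) ^+ 2 * alpha j * alpha i =
  - 2 * g (\sum_i alpha i *: f (z i)) (\sum_i alpha i *: f (z i)).
Proof.
move=> alpha0.
have E j i : mdist (z j) (z i) ^+ 2 * alpha j * alpha i =
    alpha i * (alpha j * g (f (z j)) (f (z j)))
    + alpha j * (alpha i * g (f (z i)) (f (z i)))
    - 2 * (alpha j * (alpha i * g (f (z j)) (f (z i)))).
  rewrite -isom_f dotBl !dotBr (dotC (f (z i)) (f (z j))).
  by ring.
under eq_bigr => j _ do under eq_bigr => i _ do rewrite E.
under eq_bigr => j _.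
  rewrite sumrB big_split /= -mulr_suml -!mulr_sumr alpha0 mul0r add0r.
  over.
rewrite sumrB -mulr_suml alpha0 mul0r sub0r -mulr_sumr mulNr; congr (- (_ * _)).
rewrite dot_sumZ; apply: eq_bigr => j _.
by rewrite mulr_sumr.
Qed.

Lemma strict_negative_type2P :
  strict_negative_type2 X <-> affinely_independent (range f).
Proof.
split=> [[_ strictX]|indep].
  move=> n z z_inj fz a /= az0.
  have {fz} /choice[x fx] i : exists x, f x = z i.
    by have [x _ <-] := fz i; exists x.
  (* The weight at index 0 makes the total vanish and turns the combination of the differences z_j -
     z_0 into one of the points themselves. *)
  pose alpha i := if unlift ord0 i is Some j then a j else - \sum_j a j.
  have alpha_ord0 : alpha ord0 = - \sum_j a j by rewrite /alpha unlift_none.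
  have alpha_lift j : alpha (lift ord0 j) = a j by rewrite /alpha liftK.
  have alpha0 : \sum_i alpha i = 0.
    rewrite big_ord_recl alpha_ord0 (eq_bigr _ (fun i _ => alpha_lift i)).
    exact: addNr.
  have alphaf : \sum_i alpha i *: f (x i) = 0.
    rewrite big_ord_recl alpha_ord0 -[RHS]az0 scaleNr scaler_suml fx addrC.
    by rewrite -sumrB; apply: eq_bigr => i _; rewrite alpha_lift fx scalerBr.
  have x_inj : injective x by move=> i j xij; apply: z_inj; rewrite -!fx xij.
  have [/(_ _) alpha_eq0 i|/(strictX _ _ _ x_inj alpha0)] :=
      pselect (forall i, alpha i = 0).
    by rewrite -alpha_lift alpha_eq0.
  by rewrite sum_mdist2// alphaf dot0 mulr0 ltxx.
split=> n z alpha z_inj alpha0.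
  by rewrite sum_mdist2// mulNr oppr_le0 mulr_ge0// dot_ge0.
move=> alpha_neq0; rewrite sum_mdist2// mulNr oppr_lt0 mulr_gt0//.
apply: neq0_dnorm_gt0; apply/eqP => alphaf.
apply: alpha_neq0.
(* For the empty family all weights vanish vacuously; otherwise f(z_0) serves as the base point of
   the affine dependence. *)
case: n => [|n] in z alpha z_inj alpha0 alphaf *; first by case.
have alpha_ord0 : alpha ord0 = - \sum_j alpha (lift ord0 j).
  by move: alpha0 => /eqP; rewrite big_ord_recl addr_eq0 => /eqP.
have alpha_lift : forall i : 'I_n, alpha (lift ord0 i) = 0.
  apply: (indep n (f \o z)) => [|i|/=].
  - exact: (inj_comp isom_inj z_inj).
  - by exists (z i).
  rewrite -[RHS]alphaf big_ord_recl alpha_ord0 scaleNr scaler_suml addrC.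
  by rewrite -sumrB; apply: eq_bigr => i _; rewrite scalerBr.
move=> i; have [j ->|->] := unliftP ord0 i; first exact: alpha_lift.
by rewrite alpha_ord0 big1 ?oppr0.
Qed.

End AffineIndependence.

(** * The real inner product carried by a complex Hilbert space *)

Section ComplexHilbert.
Variables (R : realType) (H : complexHilbert R).

Definition re_inner (u v : as_real H) : R := complex.Re (inner H u v).

Fact re_inner_bilinear : bilinear_for *%R (idfun \; *%R) re_inner.
Proof.
have ReM (a : R) z : complex.Re (a%:C%C * z) = a * complex.Re z.
  by case: z => x y; simpc.
split=> [w a u v|u a v w]; rewrite /re_inner.
  transitivity (complex.Re (a%:C%C * inner H u w + inner H v w)).
    congr complex.Re; exact: (linearPl (inner H)).
  by rewrite raddfD /= ReM.
transitivity (complex.Re ((a%:C%C)^* * inner H u v + inner H u w)).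
  congr complex.Re; exact: (linearPr (inner H)).
rewrite conj_Creal ?raddfD/= ?ReM //.
by rewrite complex_real.
Qed.

HB.instance Definition _ :=
  @bilinear_isBilinear.Build _ _ _ _ _ _ re_inner re_inner_bilinear.

(** Conjugation does not change the real part, so Hermitian symmetry becomes plain symmetry. *)
Fact re_inner_hermitian u v :
  re_inner u v = (-1) ^+ false * idfun (re_inner v u).
Proof.
rewrite expr0 mul1r /re_inner (hermC (inner H)) expr0 mul1r /=.
by case: (inner H v u).
Qed.

HB.instance Definition _ :=
  @isHermitianSesquilinear.Build _ _ _ _ _ re_inner_hermitian.

(** The order of [R[i]] compares real parts of numbers with equal imaginary parts, so positivity of
    <u, u> contains positivity of its real part. *)
Fact re_inner_gt0 u : u != 0 -> 0 < re_inner u u.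
Proof.
by move=> /(neq0_dnorm_gt0 (s := inner H)); rewrite ltcE => /andP[].
Qed.

HB.instance Definition _ := @isDotProduct.Build _ _ re_inner re_inner_gt0.

End ComplexHilbert.

(** * The equivalence for real and complex Hilbert spaces *)

Section Consequences.
Variables (R : realType) (X : metricType R).

Lemma strict_negative_type2_real (H : realHilbert R) (Z : set H) :
  isometric_real X Z -> strict_negative_type2 X <-> affinely_independent Z.
Proof.
move=> [f [isom_f <-]]; apply: (strict_negative_type2P (g := inner H)) => x y.
by rewrite inner_norm isom_f.
Qed.

Lemma strict_negative_type2_complex (H : complexHilbert R) (Z : set H) :
  isometric_complex X Z ->
  strict_negative_type2 X <-> affinely_independent (Z : set (as_real H)).
Proof.
move=> [f [isom_f <-]].
apply: (@strict_negative_type2P _ _ _ (@re_inner R H)) => x y.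
transitivity (complex.Re (`|f x - f y| ^+ 2)).
  congr complex.Re; exact: inner_norm.
by rewrite isom_f -rmorphXn.
Qed.

End Consequences.

(* No module axiom is required: vectors enter only through the form, and the
   completion identifies those that it does not separate. *)
Record semiInner (R : realType) := SemiInner {
  vec :> Type;
  vzero : vec;
  vadd : vec -> vec -> vec;
  vscale : R -> vec -> vec;
  sform : vec -> vec -> R;
  sformC : forall c d, sform c d = sform d c;
  sformDl : forall c c' d, sform (vadd c c') d = sform c d + sform c' d;
  sformZl : forall a c d, sform (vscale a c) d = a * sform c d;
  sform_ge0 : forall c, 0 <= sform c c }.

(** * Cauchy-Schwarz and the seminorm of a semi-inner product *)

Section SemiInnerTheory.
Variables (R : realType) (P : semiInner R).
Implicit Types (a : R) (c d : P).

Definition vsub c d := vadd c (vscale (-1) d).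

Definition seminorm c := Num.sqrt (sform c c).

Local Notation N := seminorm.

Lemma sformDr c d d' : sform c (vadd d d') = sform c d + sform c d'.
Proof. by rewrite sformC sformDl !(sformC c). Qed.

Lemma sformZr a c d : sform c (vscale a d) = a * sform c d.
Proof. by rewrite sformC sformZl sformC. Qed.

Lemma sformBl c c' d : sform (vsub c c') d = sform c d - sform c' d.
Proof. by rewrite sformDl sformZl mulN1r. Qed.

Lemma sformBr c d d' : sform c (vsub d d') = sform c d - sform c d'.
Proof. by rewrite sformC sformBl !(sformC c). Qed.

Lemma seminorm_ge0 c : 0 <= N c.
Proof. exact: sqrtr_ge0. Qed.

Lemma sqr_seminorm c : N c ^+ 2 = sform c c.
Proof. by rewrite sqr_sqrtr// sform_ge0. Qed.

(** Cauchy-Schwarz, from the nonnegativity of the form at c + t d as a polynomial in t. The form may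
    be degenerate, so <d, d> = 0 is a separate case, in which the polynomial is affine. *)
Lemma sform_sqr_le c d : sform c d ^+ 2 <= sform c c * sform d d.
Proof.
have quad t : 0 <= sform c c + 2 * t * sform c d + t ^+ 2 * sform d d.
  have := sform_ge0 (vadd c (vscale t d)).
  rewrite sformDl !sformDr !sformZl !sformZr (sformC d c).
  by lra.
have := sform_ge0 d; rewrite le_eqVlt => /predU1P[d0|d_gt0].
  rewrite -d0 mulr0 leNgt; apply/negP => b_gt0.
  have b_neq0 : sform c d != 0 by rewrite -sqrf_eq0 gt_eqF.
  (* At this t the affine polynomial would take the value -1. *)
  have := quad (- (sform c c + 1) / (2 * sform c d)).
  rewrite -d0 mulr0 addr0 leNgt => /negP; apply.
  have -> : 2 * (- (sform c c + 1) / (2 * sform c d)) * sform c d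
      = - (sform c c + 1).
    by field.
  by rewrite opprD addrA subrr add0r ltrN10.
(* This t minimises the quadratic polynomial. *)
have := quad (- sform c d / sform d d).
have -> : sform c c + 2 * (- sform c d / sform d d) * sform c d
    + (- sform c d / sform d d) ^+ 2 * sform d d
    = (sform c c * sform d d - sform c d ^+ 2) / sform d d.
  by field; rewrite gt_eqF.
by rewrite pmulr_lge0 ?invr_gt0// subr_ge0.
Qed.

Lemma norm_form_le c d : `|sform c d| <= N c * N d.
Proof.
by rewrite -sqrtrM ?sform_ge0// -sqrtr_sqr ler_wsqrtr// sform_sqr_le.
Qed.

Lemma seminormD c d : N (vadd c d) <= N c + N d.
Proof.
rewrite -ler_sqr ?nnegrE ?addr_ge0 ?seminorm_ge0//.
rewrite sqr_seminorm sqrrD !sqr_seminorm sformDl !sformDr (sformC d c).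
have := le_trans (ler_norm _) (norm_form_le c d); lra.
Qed.

Lemma seminormZ a c : N (vscale a c) = `|a| * N c.
Proof.
by rewrite /seminorm sformZl sformZr mulrA sqrtrM -?expr2 ?sqr_ge0// sqrtr_sqr.
Qed.

Lemma seminorm_le_sub c d : N c <= N (vsub c d) + N d.
Proof.
(* The vectors c and (c - d) + d need not be equal in [P], but the form gives them the same
   seminorm. *)
rewrite (_ : N c = N (vadd (vsub c d) d)) ?seminormD//.
by congr Num.sqrt; rewrite !sformDl !sformDr !sformZl !sformZr; ring.
Qed.

(** Turns a dual-norm bound e on <c, ->, tested at c itself, into a bound on the seminorm of c. *)
Lemma seminorm_le_of_form c (e : R) :
  0 <= e -> sform c c <= e * N c -> N c <= e.
Proof.
rewrite -sqr_seminorm expr2 => e0.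
have := seminorm_ge0 c; rewrite le_eqVlt => /predU1P[<-//|c_gt0].
by rewrite ler_pM2r.
Qed.

End SemiInnerTheory.

(** * Convergence of real sequences at the rate 1/(n + 1) *)

Lemma near_harmonic_lt (R : realType) (K e : R) : 0 < e ->
  \forall n \near \oo, K * harmonic n < e.
Proof.
move=> e0; have : (fun n => K * harmonic n) @ \oo --> K * 0.
  by apply: cvgMr; exact: cvg_harmonic.
by rewrite mulr0 => /(cvgr_lt 0); exact.
Qed.

(** The sequence is Cauchy, and letting m tend to infinity in the hypothesis leaves the bound for
    the limit. *)
Lemma cvg_harmonic_rate (R : realType) (x : R^nat) (K : R) :
  (forall n m, `|x n - x m| <= K * (harmonic n + harmonic m)) ->
  exists2 l, x @ \oo --> l & forall n, `|x n - l| <= K * harmonic n.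
Proof.
move=> xK.
have xc : cvg (x @ \oo).
  apply/cauchy_cvgP/cauchy_ballP => e e0; near_simpl.
  near=> n m; rewrite /ball/=.
  apply: le_lt_trans (xK n m) _; rewrite mulrDr (splitr e) ltrD//.
    by near: n; apply: near_harmonic_lt; rewrite divr_gt0.
  by near: m; apply: near_harmonic_lt; rewrite divr_gt0.
exists (lim (x @ \oo)) => // n; apply/ler_addgt0Pl => e e0.
near \oo => m.
have -> : x n - lim (x @ \oo) = (x n - x m) + (x m - lim (x @ \oo)) by ring.
apply: le_trans (ler_normD _ _) _.
apply: le_trans (lerD (xK n m) (lexx _)) _.
rewrite mulrDr (splitr e) -addrA addrC lerD2r lerD//.
  by apply/ltW; near: m; apply: near_harmonic_lt; rewrite divr_gt0.
by near: m; apply: cvgr_distC_le; rewrite ?divr_gt0.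
Unshelve. all: by end_near. Qed.

Lemma cvg_harmonic_bound (R : realType) (x : R^nat) (l K : R) :
  (forall n, `|x n - l| <= K * harmonic n) -> x @ \oo --> l.
Proof.
move=> xK; apply/cvgrPdist_lt => e /(near_harmonic_lt K).
by apply: filterS => n; rewrite distrC; exact: le_lt_trans.
Qed.

Lemma harmonic_le1 (R : realType) n : harmonic n <= 1 :> R.
Proof. by rewrite invf_le1// ler1n. Qed.

(** * Functionals approximated in the dual norm by vectors *)

Section Approximation.
Variables (R : realType) (P : semiInner R).
Implicit Types (c d : P) (f g : P -> R) (u v w : nat -> P).

Local Notation N := (@seminorm R P).

(* <u_n, -> tends to f in the dual norm. The fixed rate K / (n + 1) lets all
   limits below be controlled by a single constant. *)
Definition approximates u f (K : R) :=
  0 <= K /\ forall n d, `|f d - sform (u n) d| <= K * harmonic n * N d.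

Lemma approximates_cst c : approximates (fun=> c) (sform c) 0.
Proof. by split=> // n d; rewrite subrr normr0 !mul0r. Qed.

Lemma approximatesD u v f g K L :
  approximates u f K -> approximates v g L ->
  approximates (fun n => vadd (u n) (v n)) (fun d => f d + g d) (K + L).
Proof.
move=> [K0 uf] [L0 vg]; split=> [|n d]; first exact: addr_ge0.
rewrite sformDl opprD addrACA !mulrDl.
by apply: le_trans (ler_normD _ _) _; exact: lerD.
Qed.

Lemma approximatesZ a u f K : approximates u f K ->
  approximates (fun n => vscale a (u n)) (fun d => a * f d) (`|a| * K).
Proof.
move=> [K0 uf]; split=> [|n d]; first exact: mulr_ge0.
by rewrite sformZl -mulrBr normrM -!mulrA ler_wpM2l// mulrA.
Qed.

Lemma approximates_cvg u f K d :
  approximates u f K -> (fun n => sform (u n) d) @ \oo --> f d.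
Proof.
move=> [K0 uf]; apply: (@cvg_harmonic_bound _ _ _ (K * N d)) => n.
by rewrite distrC mulrAC.
Qed.

(** Both <u_n, -> and <u'_m, -> are close to f in the dual norm. Evaluating their difference at the
    vector u_n - u'_m bounds the square of its own seminorm. *)
Lemma approximates_dist u u' f K K' n m :
  approximates u f K -> approximates u' f K' ->
  N (vsub (u n) (u' m)) <= K * harmonic n + K' * harmonic m.
Proof.
move=> [K0 uf] [K'0 u'f]; apply: seminorm_le_of_form.
  by rewrite addr_ge0// mulr_ge0// harmonic_ge0.
set d := vsub _ _; rewrite {1}/d sformBl.
have -> : sform (u n) d - sform (u' m) d
    = (f d - sform (u' m) d) - (f d - sform (u n) d) by ring.
rewrite mulrDl [leRHS]addrC.
apply: le_trans (ler_norm _) _; apply: le_trans (ler_normB _ _) _.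
exact: lerD.
Qed.

Lemma approximates_bounded u f K :
  approximates u f K -> exists2 B, 0 <= B & forall n, N (u n) <= B.
Proof.
(* K + K bounds the distance from u_n to u_0, as the harmonic terms are at most 1. *)
move=> uf; have K0 := uf.1; exists (K + K + N (u 0)).
  by rewrite !addr_ge0// seminorm_ge0.
move=> n; apply: le_trans (seminorm_le_sub _ (u 0)) _; rewrite lerD2r.
apply: le_trans (approximates_dist n 0 uf uf) _.
by rewrite lerD// ler_piMr// harmonic_le1.
Qed.

(** Used twice: with equal sequences it makes the pairings Cauchy, and with n = m it shows that
    their limit does not depend on the approximating sequences. *)
Lemma approximates_form u u' w w' f g K K' L L' :
  approximates u f K -> approximates u' f K' ->
  approximates w g L -> approximates w' g L' ->
  exists2 C, 0 <= C & forall n m,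
    `|sform (u n) (w n) - sform (u' m) (w' m)| <= C * (harmonic n + harmonic m).
Proof.
move=> uf u'f wg w'g.
have [A A0 wA] := approximates_bounded wg.
have [B B0 u'B] := approximates_bounded u'f.
have [K0 K'0 L0 L'0] := And4 uf.1 u'f.1 wg.1 w'g.1.
exists ((K + K') * A + B * (L + L')).
  by rewrite addr_ge0 ?mulr_ge0 ?addr_ge0.
move=> n m.
(* One argument is changed at a time; Cauchy-Schwarz then bounds each term by a distance times a
   bounded seminorm. *)
have -> : sform (u n) (w n) - sform (u' m) (w' m) =
    sform (vsub (u n) (u' m)) (w n) + sform (u' m) (vsub (w n) (w' m)).
  by rewrite sformBl sformBr; ring.
have rate k l (M M' : R) : 0 <= M -> 0 <= M' ->
    M * harmonic k + M' * harmonic l <= (M + M') * (harmonic k + harmonic l).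
  move=> M0 M'0; have := mulr_ge0 M0 (@harmonic_ge0 R l).
  have := mulr_ge0 M'0 (@harmonic_ge0 R k); lra.
apply: le_trans (ler_normD _ _) _; rewrite mulrDl; apply: lerD.
  apply: le_trans (norm_form_le _ _) _.
  rewrite mulrAC ler_pM ?seminorm_ge0//.
  exact: le_trans (approximates_dist n m uf u'f) (rate _ _ _ _ _ _).
apply: le_trans (norm_form_le _ _) _.
rewrite -mulrA ler_pM ?seminorm_ge0//.
exact: le_trans (approximates_dist n m wg w'g) (rate _ _ _ _ _ _).
Qed.

End Approximation.

(** * The Hilbert completion as a space of functionals *)

Section Completion.
Variables (R : realType) (P : semiInner R).
Implicit Types (c d : P) (a : R).

Local Notation N := (@seminorm R P).

Definition approximable : {pred P -> R^o} :=
  fun f => `[< exists K u, approximates u (f : P -> R) K >].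

Fact approximable_submod_closed : subsemimod_closed approximable.
Proof.
split; first split.
(* Scaling by 0 guarantees a vector whose functional vanishes, since no axiom describes the form at
   [vzero]. *)
- apply/asboolP; exists 0, (fun=> vscale 0 (vzero P)).
  rewrite (_ : 0 = sform (vscale 0 (vzero P))); first exact: approximates_cst.
  by apply/funext => d; rewrite sformZl mul0r.
- move=> f g /asboolP[K [u uf]] /asboolP[L [v vg]]; apply/asboolP.
  by exists (K + L), (fun n => vadd (u n) (v n)); exact: approximatesD.
- move=> a f /asboolP[K [u uf]]; apply/asboolP.
  by exists (`|a| * K), (fun n => vscale a (u n)); exact: approximatesZ.
Qed.

HB.instance Definition _ :=
  GRing.isSubmodClosed.Build R (P -> R^o) approximable
    approximable_submod_closed.

Record completion := Completion {
  functional :> P -> R^o;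
  functional_approximable : functional \in approximable }.

HB.instance Definition _ := [isSub for functional].
HB.instance Definition _ := [Choice of completion by <:].
HB.instance Definition _ := [SubChoice_isSubLmodule of completion by <:].

Implicit Types f g h : completion.

Lemma functionalD f g : functional (f + g) = (fun d => f d + g d).
Proof. by rewrite -[functional]/val raddfD. Qed.

Lemma functionalZ a f : functional (a *: f) = (fun d => a * f d).
Proof. by rewrite -[functional]/val linearZ. Qed.

Lemma approximatesP f : exists uK, approximates uK.1 f uK.2.
Proof.
by have /asboolP[K [u uf]] := functional_approximable f; exists (u, K).
Qed.

Definition approximant f := (projT1 (cid (approximatesP f))).1.

Lemma approximantP f : exists K, approximates (approximant f) f K.
Proof.
by exists (projT1 (cid (approximatesP f))).2; rewrite /approximant; case: cid.
Qed.

Definition cinner f g : R :=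
  lim ((fun n => sform (approximant f n) (approximant g n)) @ \oo).

(** Frees [cinner] from the chosen approximants: every pair of approximating sequences computes
    it. *)
Lemma cinner_cvg u w f g K L : approximates u f K -> approximates w g L ->
  (fun n => sform (u n) (w n)) @ \oo --> cinner f g.
Proof.
move=> uf wg.
have [K' u'f] := approximantP f; have [L' w'g] := approximantP g.
have [C _ Crate] := approximates_form u'f u'f w'g w'g.
have [l xl Cl] := cvg_harmonic_rate Crate.
rewrite /cinner (cvg_lim _ xl)//.
have [D _ Drate] := approximates_form uf u'f wg w'g.
apply: (@cvg_harmonic_bound _ _ _ (D + D + C)) => n.
apply: le_trans (ler_distD (sform (approximant f n) (approximant g n)) _ _) _.
rewrite mulrDl lerD//; apply: le_trans (Drate n n) _.
by rewrite mulrDr -mulrDl.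
Qed.

(** The way to prove identities of [cinner]: the approximant chosen for f + g need not be the sum of
    those chosen for f and g, but that sum does approximate f + g. *)
Lemma cinner_unique u w f g K L l :
  approximates u f K -> approximates w g L ->
  (fun n => sform (u n) (w n)) @ \oo --> l -> cinner f g = l.
Proof.
move=> uf wg; exact: (cvg_unique _ (cinner_cvg uf wg)).
Qed.

Lemma cinnerC f g : cinner f g = cinner g f.
Proof.
have [K uf] := approximantP f; have [L wg] := approximantP g.
apply: (cinner_unique uf wg).
under eq_cvg do rewrite sformC.
exact: cinner_cvg wg uf.
Qed.

Lemma cinnerDl f g h : cinner (f + g) h = cinner f h + cinner g h.
Proof.
have [K uf] := approximantP f; have [L vg] := approximantP g.
have [M wh] := approximantP h.
have := approximatesD uf vg; rewrite -functionalD => /cinner_unique.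
move=> /(_ _ _ _ _ wh); apply.
under eq_cvg do rewrite sformDl.
exact: cvgD (cinner_cvg uf wh) (cinner_cvg vg wh).
Qed.

Lemma cinnerZl a f g : cinner (a *: f) g = a * cinner f g.
Proof.
have [K uf] := approximantP f; have [L wg] := approximantP g.
have := approximatesZ a uf; rewrite -functionalZ => /cinner_unique.
move=> /(_ _ _ _ _ wg); apply.
under eq_cvg do rewrite sformZl.
exact: cvgMr (cinner_cvg uf wg).
Qed.

Lemma cinner_ge0 f : 0 <= cinner f f.
Proof.
have [K uf] := approximantP f.
apply: cvgr_to_ge (cinner_cvg uf uf) _.
by apply: nearW => n; exact: sform_ge0.
Qed.

(** The limit of Cauchy-Schwarz for u_n and c. It makes the form definite: a functional of norm 0
    vanishes at every c. *)
Lemma functional_le f c : f c ^+ 2 <= cinner f f * sform c c.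
Proof.
have [K uf] := approximantP f; have fc := approximates_cvg (d := c) uf.
apply: (ler_cvg_to (cvgM fc fc) (cvgMl (cinner_cvg uf uf))).
by apply: nearW => n; have := sform_sqr_le (approximant f n) c; rewrite expr2.
Qed.

(** Lets the norm axioms of the completion be read off from the seminorm theory above. *)
Definition completion_semiInner : semiInner R :=
  @SemiInner R completion 0 +%R *:%R cinner
    cinnerC cinnerDl cinnerZl cinner_ge0.

Definition cnorm f : R := @seminorm R completion_semiInner f.

Fact cnormD f g : cnorm (f + g) <= cnorm f + cnorm g.
Proof. exact: (@seminormD R completion_semiInner). Qed.

Fact cnormZ a f : cnorm (a *: f) = `|a| * cnorm f.
Proof. exact: (@seminormZ R completion_semiInner). Qed.

Fact cnorm_eq0 f : cnorm f = 0 -> f = 0.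
Proof.
move=> f0; apply: val_inj; apply/funext => c.
have := functional_le f c.
rewrite -[cinner f f](@sqr_seminorm R completion_semiInner) [seminorm _]f0.
rewrite expr0n mul0r => fc; apply/eqP.
by rewrite -sqrf_eq0 eq_le fc sqr_ge0.
Qed.

HB.instance Definition _ :=
  Lmodule_isNormed.Build R completion cnormD cnormZ cnorm_eq0.

Lemma completion_normE f : `|f| = Num.sqrt (cinner f f). Proof. by []. Qed.

Fact cinner_bilinear : bilinear_for *%R (idfun \; *%R) cinner.
Proof.
by split=> [h a f g|h a f g]; rewrite ?(cinnerC h) cinnerDl cinnerZl.
Qed.

HB.instance Definition _ :=
  @bilinear_isBilinear.Build _ _ _ _ _ _ cinner cinner_bilinear.

Fact cinner_hermitian f g : cinner f g = (-1) ^+ false * idfun (cinner g f).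
Proof. by rewrite expr0 mul1r cinnerC. Qed.

HB.instance Definition _ :=
  @isHermitianSesquilinear.Build _ _ _ _ _ cinner_hermitian.

Fact cinner_gt0 f : f != 0 -> 0 < cinner f f.
Proof. by rewrite -normr_gt0 completion_normE sqrtr_gt0. Qed.

HB.instance Definition _ := @isDotProduct.Build _ _ cinner cinner_gt0.

Fact embed_approximable c : (sform c : P -> R^o) \in approximable.
Proof.
by apply/asboolP; exists 0, (fun=> c); exact: approximates_cst.
Qed.

Definition embed c : completion := Completion (embed_approximable c).

Lemma norm_sub_embed c d : `|embed c - embed d| = N (vsub c d).
Proof.
rewrite completion_normE; congr Num.sqrt.
have cd : approximates (fun=> vsub c d) (embed c - embed d) (0 + `|-1| * 0).
  rewrite -scaleN1r functionalD functionalZ.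
  exact: approximatesD (approximates_cst c)
    (approximatesZ _ (approximates_cst d)).
by apply: (cinner_unique cd cd); exact: cvg_cst.
Qed.

(** The sequence u_m - u_n, indexed by m, approximates f - [embed (u n)], and for m >= n its
    seminorms are at most K (1/(m+1) + 1/(n+1)) <= 2K/(n+1). *)
Lemma approximates_norm u f K n :
  approximates u f K -> `|f - embed (u n)| <= (K + K) * harmonic n.
Proof.
move=> uf; have K0 := uf.1.
have r0 : 0 <= (K + K) * harmonic n by rewrite mulr_ge0 ?addr_ge0 ?harmonic_ge0.
have ufn : approximates (fun m => vsub (u m) (u n)) (f - embed (u n))
    (K + `|-1| * 0).
  rewrite -scaleN1r functionalD functionalZ.
  exact: approximatesD uf (approximatesZ _ (approximates_cst (u n))).
rewrite completion_normE -(ger0_norm r0) -sqrtr_sqr ler_wsqrtr//.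
apply: cvgr_to_le (cinner_cvg ufn ufn) _.
exists n => // m /= nm; rewrite -sqr_seminorm ler_sqr ?nnegrE ?seminorm_ge0//.
apply: le_trans (approximates_dist m n uf uf) _.
by rewrite mulrDl lerD2r ler_wpM2l// lef_pV2 ?posrE// ler_nat ltnS.
Qed.

Lemma embed_dense f (e : R) : 0 < e -> exists c, `|f - embed c| < e.
Proof.
move=> e0; have [K uf] := approximantP f.
have [n ne] := filter_ex (near_harmonic_lt (K + K) e0).
exists (approximant f n); exact: le_lt_trans (approximates_norm n uf) ne.
Qed.

(** Density replaces the Cauchy filter by a sequence of embedded vectors c_n with an explicit Cauchy
    rate. The functionals <c_n, -> then converge pointwise, and the rate puts their limit in the
    completion. *)
Fact completion_complete (F : set_system completion) :
  ProperFilter F -> cauchy F -> cvg F.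
Proof.
move=> FF /cauchyP Fcauchy.
(* One [harmonic n] is the radius of a ball in F, the other the cost of moving its centre to an
   embedded vector. *)
have /choice[c cF] n : exists c, F (ball (embed c) (2 * harmonic n)).
  have [f Ff] := Fcauchy _ (harmonic_gt0 n).
  have [c fc] := embed_dense f (harmonic_gt0 n).
  exists c; apply: filterS Ff => g; rewrite -!ball_normE /ball_/= => fg.
  rewrite mulr2n mulrDl mul1r.
  by apply: le_lt_trans (ler_distD f _ _) _; rewrite distrC ltrD.
have c_dist n m : N (vsub (c n) (c m)) <= 2 * (harmonic n + harmonic m).
  rewrite -norm_sub_embed.
  have [g []] := filter_ex (filterI (cF n) (cF m)).
  rewrite -!ball_normE /ball_/= => ng mg.
  apply: le_trans (ler_distD g _ _) _.
  by rewrite mulrDr lerD// ltW// distrC.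
have rate d n m :
    `|sform (c n) d - sform (c m) d| <= 2 * N d * (harmonic n + harmonic m).
  rewrite -sformBl; apply: le_trans (norm_form_le _ _) _.
  by rewrite mulrAC ler_wpM2r ?seminorm_ge0.
have /choice[f cf] d : exists l, forall n,
    `|sform (c n) d - l| <= 2 * N d * harmonic n.
  by have [l _ ?] := cvg_harmonic_rate (rate d); exists l.
have cf_approx : approximates c f 2.
  by split=> // n d; rewrite distrC mulrAC.
have fP : (f : P -> R^o) \in approximable by apply/asboolP; exists 2, c.
apply/cvg_ex; exists (Completion fP); apply/cvgrPdist_lt => e e0.
(* 6 = (2 + 2) + 2: [approximates_norm] with K = 2, plus the radius of the ball around
   [embed (c n)]. *)
have [n ne] := filter_ex (near_harmonic_lt 6 e0).
apply: filterS (cF n) => g; rewrite -ball_normE /ball_/= => ng.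
apply: le_lt_trans (ler_distD (embed (c n)) _ _) _.
apply: lt_trans ne.
have -> : 6 * harmonic n = (2 + 2) * harmonic n + 2 * harmonic n :> R by ring.
by rewrite ler_ltD// (approximates_norm (f := Completion fP)).
Qed.

HB.instance Definition _ := Uniform_isComplete.Build completion
  completion_complete.

Fact cinner_norm f : cinner f f = `|f| ^+ 2.
Proof. by rewrite completion_normE sqr_sqrtr// cinner_ge0. Qed.

Definition completion_hilbert : realHilbert R :=
  HilbertSpace (hilbert_sort := completion) cinner_norm.

End Completion.

(** * Embedding a space of 2-negative type through formal combinations of points *)

Section FormalCombinations.
Variables (R : realType) (X : metricType R).
Implicit Types (c d : seq (R * X)).

(** Formal combinations are lists of weighted points with repetitions allowed, so that addition is
    concatenation. *)
Definition mdist2_form c d : R :=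
  \sum_(p <- c) \sum_(q <- d) p.1 * q.1 * mdist p.2 q.2 ^+ 2.

Lemma mdist2_formC c d : mdist2_form c d = mdist2_form d c.
Proof.
rewrite /mdist2_form exchange_big; apply: eq_bigr => q _.
by apply: eq_bigr => p _; rewrite metric_sym (mulrC p.1).
Qed.

Lemma mdist2_form_cat c c' d :
  mdist2_form (c ++ c') d = mdist2_form c d + mdist2_form c' d.
Proof. by rewrite /mdist2_form big_cat. Qed.

Definition comb_scale (a : R) c := [seq (a * p.1, p.2) | p <- c].

Lemma mdist2_form_scale a c d :
  mdist2_form (comb_scale a c) d = a * mdist2_form c d.
Proof.
rewrite /mdist2_form big_map mulr_sumr; apply: eq_bigr => p _.
by rewrite mulr_sumr; apply: eq_bigr => q _; rewrite !mulrA.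
Qed.

(** Collects the weights of repeated points, because negative type speaks of distinct points
    only. *)
Lemma sum_by_point c (F : X -> R) :
  \sum_(p <- c) p.1 * F p.2 =
  \sum_(x <- undup [seq p.2 | p <- c]) (\sum_(p <- c | p.2 == x) p.1) * F x.
Proof.
under [RHS]eq_bigr => x _ do rewrite mulr_suml.
rewrite (exchange_big_dep xpredT)//= big_seq [RHS]big_seq.
apply: eq_bigr => p pc.
rewrite (eq_bigl (pred1 p.2)) => [|x]; last by rewrite eq_sym.
rewrite -big_filter filter_pred1_uniq ?undup_uniq ?mem_undup ?map_f//.
by rewrite big_seq1.
Qed.

Lemma mdist2_form_le0 c : negative_type2 X ->
  \sum_(p <- c) p.1 = 0 -> mdist2_form c c <= 0.
Proof.
move=> negX c0.
set s := undup [seq p.2 | p <- c].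
pose alpha x := \sum_(p <- c | p.2 == x) p.1.
have sumE F : \sum_(p <- c) p.1 * F p.2 =
    \sum_(i < size s) alpha (tnth (in_tuple s) i) * F (tnth (in_tuple s) i).
  by rewrite sum_by_point -/s big_tnth.
have alpha0 : \sum_(i < size s) alpha (tnth (in_tuple s) i) = 0.
  (* The total weight is the case F = 1 of [sumE]. *)
  rewrite -[RHS]c0; under eq_bigr do rewrite -[alpha _]mulr1.
  by under [RHS]eq_bigr do rewrite -[_.1]mulr1; rewrite (sumE (fun=> 1)).
have s_inj : injective (tnth (in_tuple s)) by apply/tuple_uniqP/undup_uniq.
apply: le_trans (negX _ _ _ s_inj alpha0); rewrite le_eqVlt; apply/orP; left.
apply/eqP; rewrite /mdist2_form.
under eq_bigr => p _.
  under eq_bigr => q _ do rewrite -mulrA.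
  rewrite -mulr_sumr (sumE (fun y => mdist p.2 y ^+ 2)).
  over.
rewrite (sumE (fun x => \sum_(i < size s) alpha (tnth (in_tuple s) i) *
  mdist x (tnth (in_tuple s) i) ^+ 2)).
apply: eq_bigr => j _; rewrite mulr_sumr; apply: eq_bigr => i _; ring.
Qed.

Record zero_sum := ZeroSum {
  comb :> seq (R * X);
  zero_sumP : \sum_(p <- comb) p.1 = 0 }.

Implicit Types (u v w : zero_sum).

Fact zero_sum_nil : \sum_(p <- [::] : seq (R * X)) p.1 = 0.
Proof. by rewrite big_nil. Qed.

Fact zero_sum_cat u v : \sum_(p <- comb u ++ comb v) p.1 = 0.
Proof. by rewrite big_cat /= !zero_sumP addr0. Qed.

Fact zero_sum_scale a u : \sum_(p <- comb_scale a u) p.1 = 0.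
Proof. by rewrite big_map -mulr_sumr zero_sumP mulr0. Qed.

Fact zero_sum_sub x0 x : \sum_(p <- [:: (1 : R, x : X); (-1, x0)]) p.1 = 0.
Proof. by rewrite !big_cons big_nil addr0 subrr. Qed.

Definition zero_sum_form u v : R := - 2^-1 * mdist2_form u v.

Fact zero_sum_formC u v : zero_sum_form u v = zero_sum_form v u.
Proof. by rewrite /zero_sum_form mdist2_formC. Qed.

Fact zero_sum_formDl u v w :
  zero_sum_form (ZeroSum (zero_sum_cat u v)) w =
  zero_sum_form u w + zero_sum_form v w.
Proof. by rewrite /zero_sum_form mdist2_form_cat mulrDr. Qed.

Fact zero_sum_formZl a u v :
  zero_sum_form (ZeroSum (zero_sum_scale a u)) v = a * zero_sum_form u v.
Proof. by rewrite /zero_sum_form mdist2_form_scale mulrCA. Qed.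

Hypothesis negX : negative_type2 X.

Fact zero_sum_form_ge0 u : 0 <= zero_sum_form u u.
Proof.
rewrite /zero_sum_form mulNr oppr_ge0 pmulr_rle0 ?invr_gt0//.
exact: mdist2_form_le0 (zero_sumP u).
Qed.

Definition zero_sum_semiInner : semiInner R :=
  SemiInner (ZeroSum zero_sum_nil) zero_sum_formC zero_sum_formDl
    zero_sum_formZl zero_sum_form_ge0.

Definition point_embed (x0 x : X) : completion zero_sum_semiInner :=
  @embed R zero_sum_semiInner (ZeroSum (zero_sum_sub x0 x)).

(** The distances to the base point cancel in (x - x0) - (y - x0), leaving -1/2 times -2 d(x,
    y)^2. *)
Lemma norm_point_embed x0 x y :
  `|point_embed x0 x - point_embed x0 y| = mdist x y.
Proof.
rewrite /point_embed norm_sub_embed -[RHS]ger0_norm ?mdist_ge0// -sqrtr_sqr.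
congr Num.sqrt; rewrite sformBl !sformBr /= /zero_sum_form /mdist2_form /=.
rewrite !big_cons !big_nil /= !mdistxx (metric_sym x0) (metric_sym x0 y).
rewrite (metric_sym y x).
by field.
Qed.

Lemma negative_type2_hilbert :
  exists H : realHilbert R, exists Z : set H, isometric_real X Z.
Proof.
exists (completion_hilbert zero_sum_semiInner).
(* A base point exists only if X is inhabited; an empty X is isometric to the empty set. *)
have [[x0]|X0] := pselect (inhabited X).
  exists (range (point_embed x0)), (point_embed x0); split=> // x y.
  exact: norm_point_embed.
exists set0, (fun=> 0); split=> [x|]; first by case: X0; exists.
by apply/seteqP; split=> // z [x]; case: X0; exists.
Qed.

End FormalCombinations.

Theorem theorem5p6 (R : realType) :
  (forall X : metricType R,
     strict_negative_type2 X <->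
     exists (H : realHilbert R) (Z : set H),
       affinely_independent Z /\ isometric_real X Z)
  /\
  (forall X : metricType R, strict_negative_type2 X ->
     (forall (H : realHilbert R) (Z : set H),
        affinely_dependent Z -> ~ isometric_real X Z)
     /\
     (forall (H : complexHilbert R) (Z : set H),
        affinely_dependent (Z : set (as_real H)) -> ~ isometric_complex X Z)).
Proof.
split=> X; [split|move=> strictX; split].
(* The space comes from 2-negative type alone; strictness then gives the affine independence of the
   image. *)
- move=> strictX; have [H [Z isoZ]] := negative_type2_hilbert strictX.1.
  exists H, Z; split=> //.
  exact/(strict_negative_type2_real isoZ).
- by move=> [H [Z [indepZ /strict_negative_type2_real ->]]].
- by move=> H Z depZ /strict_negative_type2_real[/(_ strictX)/depZ].
- by move=> H Z depZ /strict_negative_type2_complex[/(_ strictX)/depZ].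
Qed.
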